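(* Let $k$ be a field of characteristic zero, let $\mathcal{M}$ be any of the following categories of chain complexes over $k$: non-negatively graded, non-positively graded, or unbounded chain complexes or cochain complexes, with its standard model structure, and let $K$ be a set of cofibrant objects of $\mathcal{M}$. Then $\mathcal{M}$ satisfies $\diamond$. Furthermore, for any colored operad $O$ valued in $\mathcal{M}$, $O$ satisfies $\star^{O}$ if $O$ is objectwise $K$-colocal.
   Context: The model structures have the quasi-isomorphisms as weak equivalences; the fibrations are the degreewise surjections for unbounded complexes and for $\mathrm{Ch}^{\ge0}(k)$, and the maps surjective in positive degrees for $\mathrm{Ch}_{\ge0}(k)$ (formally dually in the other cases). The tensor product is the usual tensor product of complexes over $k$. With $\mathrm{map}(-,-)$ the homotopy function complex of $\mathcal{M}$, $f$ is a $K$-colocal equivalence if $\mathrm{map}(A,f)$ is a weak equivalence for every $A\in K$; an object $W$ is $K$-colocal if it is cofibrant in $\mathcal{M}$ and $\mathrm{map}(W,f)$ is a weak equivalence for every $K$-colocal equivalence $f$. $\diamond$: for each $n\ge1$, each $X\in\mathcal{M}^{\Sigma_n^{op}}$ that is a $K$-colocal object in $\mathcal{M}$, and each map $\beta:U\to V$ in $\mathcal{M}^{\Sigma_n^{op}}$ that is both a fibration in $\mathcal{M}$ and a $K$-colocal equivalence, every map $X\to V$ in $\mathcal{M}^{\Sigma_n^{op}}$ lifts through $\beta$ to a map $X\to U$ in $\mathcal{M}^{\Sigma_n^{op}}$. For a non-empty set $\mathfrak{C}$ of colors, $\Sigma_{\mathfrak{C}}$ is the groupoid of finite sequences (profiles)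 in $\mathfrak{C}$ with permutations as morphisms; $[\underline{c}]$ is the orbit of $\underline c$ and $\Sigma_{[\underline{c}]}$ its connected component. A $\mathfrak{C}$-colored symmetric sequence in $\mathcal{M}$ is a functor $X:\Sigma_{\mathfrak{C}}^{op}\times\mathfrak{C}\to\mathcal{M}$, with entries $X\binom{d}{\underline{c}}$ and components $X\binom{d}{[\underline{c}]}\in\mathcal{M}^{\Sigma_{[\underline{c}]}^{op}\times\{d\}}$; a $\mathfrak{C}$-colored operad is a monoid in symmetric sequences for the colored circle product (i.e. a symmetric operad with color set $\mathfrak{C}$ in the usual sense), and in particular has an underlying symmetric sequence. Objectwise $K$-colocal means that every entry is $K$-colocal in $\mathcal{M}$. $\star^X$ (for a $\mathfrak{C}$-colored symmetric sequence $X$): for each map $p:E\to B$ of $\mathfrak{C}$-colored symmetric sequences in $\mathcal{M}$ that is entrywise both a fibration in $\mathcal{M}$ and a $K$-colocal equivalence, and for each $d\in\mathfrak{C}$ and orbit $[\underline{c}]$, every map $X\binom{d}{[\underline{c}]}\to B\binom{d}{[\underline{c}]}$ in $\mathcal{M}^{\Sigma_{[\underline{c}]}^{op}\times\{d\}}$ lifts through $p:E\binom{d}{[\underline{c}]}\to B\binom{d}{[\underline{c}]}$. *)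

(* Defs.v *)
From HB Require Import structures.
From mathcomp Require Import all_boot all_order all_fingroup all_algebra.
From mathcomp Require Import all_classical.

Set Implicit Arguments.
Unset Strict Implicit.
Unset Printing Implicit Defensive.

Import GRing.Theory.

(** * Categories *)

Record category := Category {
  obj :> Type;
  hom : obj -> obj -> Type;
  cid : forall x, hom x x;
  ccomp : forall x y z, hom y z -> hom x y -> hom x z;
  ccompA : forall x y z t (h : hom z t) (g : hom y z) (f : hom x y),
    ccomp h (ccomp g f) = ccomp (ccomp h g) f;
  ccomp1l : forall x y (f : hom x y), ccomp (cid y) f = f;
  ccomp1r : forall x y (f : hom x y), ccomp f (cid x) = f }.

Arguments hom {c}.
Arguments cid {c}.
Arguments ccomp {c x y z}.

Declare Scope cat_scope.
Delimit Scope cat_scope with cat.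
Local Open Scope cat_scope.

Notation "g ∘ f" := (ccomp g f) (at level 40, left associativity) : cat_scope.

Record functor (C D : category) := Functor {
  fobj :> C -> D;
  fmor : forall x y, hom x y -> hom (fobj x) (fobj y);
  fmor_id : forall x, fmor (cid x) = cid (fobj x);
  fmor_comp : forall x y z (g : hom y z) (f : hom x y),
    fmor (g ∘ f) = fmor g ∘ fmor f }.

Arguments fmor {C D} f0 {x y}.

Record nattrans (C D : category) (F G : functor C D) := Nattrans {
  ncomp :> forall x, hom (F x) (G x);
  ncompE : forall x y (f : hom x y), ncomp y ∘ fmor F f = fmor G f ∘ ncomp x }.

Definition op (C : category) : category.
Proof.
exists C (fun x y => hom y x) cid (fun x y z g f => f ∘ g).
- by move=> *; rewrite ccompA.
- by move=> *; rewrite ccomp1r.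
- by move=> *; rewrite ccomp1l.
Defined.

Definition prod_cat (C D : category) : category.
Proof.
exists (C * D)%type (fun x y => (hom x.1 y.1 * hom x.2 y.2)%type)
  (fun x => (cid x.1, cid x.2))
  (fun x y z g f => (g.1 ∘ f.1, g.2 ∘ f.2)).
- by move=> *; rewrite /= !ccompA.
- by move=> x y [f g]; rewrite /= !ccomp1l.
- by move=> x y [f g]; rewrite /= !ccomp1r.
Defined.

Definition discrete (T : Type) : category.
Proof.
exists T (fun x y => x = y) (@erefl T) (fun x y z g f => etrans f g).
- by move=> *; apply: Prop_irrelevance.
- by move=> *; apply: Prop_irrelevance.
- by move=> *; apply: Prop_irrelevance.
Defined.

Definition full_subcat (C : category) (P : C -> Prop) : category.
Proof.
exists {x : C | P x} (fun x y => hom (sval x) (sval y)) (fun x => cid (sval x))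
  (fun x y z g f => g ∘ f).
- by move=> *; apply: ccompA.
- by move=> *; apply: ccomp1l.
- by move=> *; apply: ccomp1r.
Defined.

Definition incl (C : category) (P : C -> Prop) : functor (full_subcat P) C :=
  @Functor (full_subcat P) C sval (fun x y f => f) (fun x => erefl)
    (fun x y z g f => erefl).

Definition fcomp (C D E : category) (G : functor D E) (F : functor C D) :
  functor C E.
Proof.
exists (fun x => G (F x)) (fun x y f => fmor G (fmor F f)).
- by move=> x; rewrite !fmor_id.
- by move=> *; rewrite !fmor_comp.
Defined.

Definition whisker (C D E : category) (F G : functor D E) (p : nattrans F G)
  (H : functor C D) : nattrans (fcomp F H) (fcomp G H).
Proof. by exists (fun x => p (H x)) => x y f; apply: (ncompE p (fmor H f)). Defined.

Definition const_functor (C D : category) (y : D) : functor C D.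
Proof.
by exists (fun=> y) (fun _ _ _ => cid y) => // *; rewrite ccomp1l.
Defined.

(** [g : X -> V] factors through [b : U -> V] in a functor category. *)
Definition nat_lifts (C D : category) (X U V : functor C D)
    (b : nattrans U V) (g : nattrans X V) : Prop :=
  exists h : nattrans X U, forall x, b x ∘ h x = g x.

Definition type_cat : category :=
  @Category Type (fun A B => A -> B) (fun A x => x) (fun A B D g f x => g (f x))
    (fun _ _ _ _ _ _ _ => erefl) (fun _ _ _ => erefl) (fun _ _ _ => erefl).

(** * Simplicial sets *)

(** The object [n] of [Delta] is the ordinal {0 < ... < n}. *)
Record dmap (m n : nat) := Dmap {
  dfun :> 'I_m.+1 -> 'I_n.+1;
  dmono : forall i j : 'I_m.+1, i <= j -> dfun i <= dfun j }.

Lemma dmapP m n (f g : dmap m n) : dfun f =1 dfun g -> f = g.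
Proof.
case: f g => [f fm] [g gm] /= /funext e; case: g / e gm => gm.
by congr Dmap; apply: Prop_irrelevance.
Qed.

Definition dmap_id n : dmap n n := @Dmap n n id (fun _ _ h => h).

Definition dmap_comp l m n (g : dmap m n) (f : dmap l m) : dmap l n :=
  @Dmap l n (fun i => g (f i)) (fun _ _ h => dmono g (dmono f h)).

Definition Delta : category.
Proof.
exists nat dmap dmap_id dmap_comp.
- by move=> *; apply: dmapP.
- by move=> *; apply: dmapP.
- by move=> *; apply: dmapP.
Defined.

Definition coface (n : nat) (i : 'I_n.+2) : dmap n n.+1.
Proof. by exists (lift i) => j k jk; rewrite /= leq_bump2. Defined.

Definition collapse (n : nat) : dmap n 0.
Proof. by exists (fun=> ord0). Defined.

Notation sset := (functor (op Delta) type_cat).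

Section SimplicialSets.
Variable X : sset.

Definition face n (i : 'I_n.+2) (x : X n.+1) : X n :=
  @fmor _ _ X n.+1 n (coface i) x.

Definition degenerate (v : X 0) n : X n := @fmor _ _ X 0 n (collapse n) v.

(** The boundary of [x] is constant at the vertex [v]. *)
Definition spherical (v : X 0) n (x : X n) : Prop :=
  forall m (s : dmap m n), m < n -> @fmor _ _ X n m s x = degenerate v m.

(** The homotopy relation on spherical simplices (for Kan complexes). *)
Definition homotopic (v : X 0) n (x x' : X n) : Prop :=
  exists w : X n.+1,
    [/\ face (inord n) w = x, face ord_max w = x' &
        forall i : 'I_n.+2, i < n -> face i w = degenerate v n].

Definition edge_related (x x' : X 0) : Prop :=
  exists w : X 1, face ord0 w = x /\ face ord_max w = x'.

End SimplicialSets.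

(** [f] induces a bijection from the [R]-classes of [S] to the [R']-classes of
    [S']. *)
Definition class_bijective (A B : Type) (S : A -> Prop) (R : A -> A -> Prop)
    (S' : B -> Prop) (R' : B -> B -> Prop) (f : A -> B) : Prop :=
  [/\ forall x, S x -> S' (f x),
      forall x x', S x -> S x' -> R' (f x) (f x') <-> R x x' &
      forall y, S' y -> exists2 x, S x & R' (f x) y].

(** Weak equivalences of Kan complexes: bijections on pi_0 and on pi_n at every
    vertex.  This is only applied to homotopy function complexes, which are
    Kan complexes. *)
Definition sset_weq (X Y : sset) (f : nattrans X Y) : Prop :=
  class_bijective (fun=> True) (@edge_related X) (fun=> True) (@edge_related Y)
    (f 0) /\
  forall (v : X 0) n, 0 < n ->
    class_bijective (@spherical X v n) (@homotopic X v n)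
      (@spherical Y (f 0 v) n) (@homotopic Y (f 0 v) n) (f n).

(** * Model structures *)

(** The weak equivalences and the fibrations determine the cofibrations. *)
Record model_cat := ModelCat {
  mcat :> category;
  weq : forall x y : mcat, hom x y -> Prop;
  fib : forall x y : mcat, hom x y -> Prop }.

Section Model.
Variable M : model_cat.

Definition llp (A B X Y : M) (i : hom A B) (p : hom X Y) : Prop :=
  forall (u : hom A X) (v : hom B Y), p ∘ u = v ∘ i ->
  exists2 h : hom B X, h ∘ i = u & p ∘ h = v.

Definition cof (A B : M) (i : hom A B) : Prop :=
  forall (X Y : M) (p : hom X Y), fib p -> weq p -> llp i p.

Definition initial (I : M) : Prop :=
  forall X : M, exists f : hom I X, forall g, g = f.

Definition cofibrant (X : M) : Prop :=
  exists I (f : hom I X), initial I /\ cof f.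

Section Latching.
Variables (R : functor Delta M) (n : nat).

(** Objects of the latching category: the injections [m] -> [n] other than the
    identity. *)
Definition latching m (s : dmap m n) : Prop := m < n /\ injective s.

Record latching_cocone (T : M) := LatchingCocone {
  leg : forall m (s : dmap m n), latching s -> hom (R m) T;
  leg_comp : forall l m (t : dmap l m) (s : dmap m n)
      (hs : latching s) (hst : latching (@ccomp Delta _ _ _ s t)),
    injective t -> leg hst = leg hs ∘ @fmor _ _ R l m t }.

Definition is_latching_object (L : M) (c : latching_cocone L) : Prop :=
  forall (T : M) (c' : latching_cocone T),
  exists! u : hom L T,
    forall m (s : dmap m n) (hs : latching s), u ∘ leg c hs = leg c' hs.

End Latching.

(** All latching maps are cofibrations. *)
Definition reedy_cofibrant (R : functor Delta M) : Prop :=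
  forall n, exists (L : M) (c : latching_cocone R n L) (l : hom L (R n)),
    [/\ is_latching_object c,
        forall m (s : dmap m n) (hs : latching s),
          l ∘ leg c hs = @fmor _ _ R m n s &
        cof l].

(** A cosimplicial resolution of [A]: a Reedy cofibrant approximation to the
    constant cosimplicial object at [A]. *)
Definition cosimplicial_resolution (A : M) (R : functor Delta M)
    (r : nattrans R (const_functor Delta A)) : Prop :=
  reedy_cofibrant R /\ forall n, weq (r n).

Definition map_sset (R : functor Delta M) (X : M) : sset.
Proof.
apply: (@Functor (op Delta) type_cat (fun n : nat => hom (R n) X)
  (fun m n s (u : hom (R m) X) => u ∘ @fmor _ _ R n m s)).
- by move=> n; apply: funext => u; rewrite /= (fmor_id R) ccomp1r.
- by move=> l m n g f; apply: funext => u; rewrite /= fmor_comp ccompA.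
Defined.

Definition map_sset_post (R : functor Delta M) (X Y : M) (f : hom X Y) :
  nattrans (map_sset R X) (map_sset R Y).
Proof.
by exists (fun n u => f ∘ u) => m n s; apply: funext => u /=; rewrite ccompA.
Defined.

(** [map(A, f)] is a weak equivalence.  The homotopy function complex
    [map(A, X)] is the left one, [M(R, X)] for a cosimplicial resolution [R] of
    [A]; up to weak equivalence it does not depend on [R].  No fibrant
    approximation to [X] is made: this requires [X] to be fibrant, as every
    object of the categories of complexes below is. *)
Definition map_weq (A X Y : M) (f : hom X Y) : Prop :=
  exists (R : functor Delta M) (r : nattrans R (const_functor Delta A)),
    cosimplicial_resolution r /\ sset_weq (map_sset_post R f).

Variable K : M -> Prop.

Definition colocal_equivalence (X Y : M) (f : hom X Y) : Prop :=
  forall A, K A -> map_weq A f.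

Definition colocal (W : M) : Prop :=
  cofibrant W /\
  forall (X Y : M) (f : hom X Y), colocal_equivalence f -> map_weq W f.

End Model.

(** * Equivariant objects *)

(** The symmetric group as a groupoid with one object; in MathComp [(f * g)%g]
    is "first [f], then [g]". *)
Definition Sigma (n : nat) : category.
Proof.
exists unit (fun _ _ => {perm 'I_n}) (fun=> 1%g) (fun _ _ _ g f => (f * g)%g).
- by move=> *; rewrite mulgA.
- by move=> *; rewrite mulg1.
- by move=> *; rewrite mul1g.
Defined.

Definition diamond (M : model_cat) (K : M -> Prop) : Prop :=
  forall n, 1 <= n ->
  forall (X U V : functor (op (Sigma n)) M) (b : nattrans U V),
    colocal K (X tt) -> fib (b tt) -> colocal_equivalence K (b tt) ->
    forall g : nattrans X V, nat_lifts b g.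

(** * Colored symmetric sequences *)

Section Profiles.
Variable C : Type.

Definition color (c : seq C) (i : 'I_(size c)) : C := tnth (in_tuple c) i.

Record prof_map (c c' : seq C) := ProfMap {
  prof_fun :> 'I_(size c) -> 'I_(size c');
  prof_bij : bijective prof_fun;
  prof_color : forall i, color (prof_fun i) = color i }.

Lemma prof_mapP c c' (f g : prof_map c c') : prof_fun f =1 prof_fun g -> f = g.
Proof.
case: f g => [f fb fc] [g gb gc] /= /funext e; case: g / e gb gc => gb gc.
by congr ProfMap; apply: Prop_irrelevance.
Qed.

Definition prof_map_id c : prof_map c c :=
  @ProfMap c c id (Bijective (fun=> erefl) (fun=> erefl)) (fun=> erefl).

Definition prof_map_comp a b c (g : prof_map b c) (f : prof_map a b) : prof_map a c :=
  @ProfMap a c (fun i => g (f i)) (bij_comp (prof_bij g) (prof_bij f))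
    (fun i => etrans (prof_color g (f i)) (prof_color f i)).

Definition Sigma_col : category.
Proof.
exists (seq C) prof_map prof_map_id prof_map_comp.
- by move=> *; apply: prof_mapP.
- by move=> *; apply: prof_mapP.
- by move=> *; apply: prof_mapP.
Defined.

(** The component of [Sigma_col^op x C] on the orbit of [c] and the color [d]. *)
Definition orbit_at (c : seq C) (d : C) : category :=
  full_subcat (C := prod_cat (op Sigma_col) (discrete C))
    (fun x => inhabited (prof_map c x.1) /\ x.2 = d).

End Profiles.

Notation symseq C M := (functor (prod_cat (op (Sigma_col C)) (discrete C)) M).

Section SymmetricSequences.
Variables (C : Type) (M : model_cat).

Definition entry (X : symseq C M) (c : seq C) (d : C) : M := X (c, d).

Definition restr (X : symseq C M) c d : functor (orbit_at c d) M :=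
  fcomp X (incl _).

Definition restr_nat (X Y : symseq C M) (p : nattrans X Y) c d :
  nattrans (restr X c d) (restr Y c d) := whisker p (incl _).

Variable K : M -> Prop.

Definition objectwise_colocal (X : symseq C M) : Prop :=
  forall c d, colocal K (entry X c d).

Definition star (X : symseq C M) : Prop :=
  forall (E B : symseq C M) (p : nattrans E B),
    (forall c d, fib (p (c, d)) /\ colocal_equivalence K (p (c, d))) ->
    forall (c : seq C) (d : C) (g : nattrans (restr X c d) (restr B c d)),
      nat_lifts (restr_nat p c d) g.

End SymmetricSequences.

(** * Complexes *)

Local Open Scope ring_scope.

Inductive direction := Chain | Cochain.

Inductive grading := Nonneg | Nonpos | Unbounded.

Definition eps (v : direction) : int :=
  match v with Chain => -1 | Cochain => 1 end.

Definition in_range (r : grading) (n : int) : bool :=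
  match r with Nonneg => 0 <= n | Nonpos => n <= 0 | Unbounded => true end.

(** Where fibrations have to be surjective.  Reindexing by [n |-> - n] exchanges
    chain and cochain complexes. *)
Definition fib_range (v : direction) (r : grading) (n : int) : bool :=
  match v, r with
  | Chain, Nonneg => 0 < n
  | Cochain, Nonpos => n < 0
  | _, _ => true
  end.

Section Complexes.
Variables (k : fieldType) (v : direction) (r : grading).

(** Bounded complexes are the Z-graded ones that vanish outside the range. *)
Record complex := Complex {
  deg :> int -> lmodType k;
  dif : forall n, {linear deg n -> deg (n + eps v)};
  dif2 : forall n (x : deg n), dif (n + eps v) (dif n x) = 0;
  deg_range : forall n, ~~ in_range r n -> forall x : deg n, x = 0 }.

Record cmap (X Y : complex) := Cmap {
  cfun :> forall n, {linear X n -> Y n};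
  cfun_dif : forall n (x : X n), cfun _ (dif X n x) = dif Y n (cfun n x) }.

Lemma linear_ext (U V : lmodType k) (f g : {linear U -> V}) : f =1 g -> f = g.
Proof.
case: f g => [f cf] [g cg] /= /funext e; case: g / e cg => cg.
congr GRing.Linear.Pack.
case: cf cg => [[a] [b]] [[a'] [b']].
by rewrite (Prop_irrelevance a a') (Prop_irrelevance b b').
Qed.

Lemma cmapP (X Y : complex) (f g : cmap X Y) :
  (forall n, cfun f n =1 cfun g n) -> f = g.
Proof.
case: f g => [f fd] [g gd] /= e.
have efg : f = g by apply: functional_extensionality_dep => n; exact: linear_ext (e n).
by case: g / efg gd {e} => gd; congr Cmap; apply: Prop_irrelevance.
Qed.

Definition cmap_id (X : complex) : cmap X X :=
  @Cmap X X (fun n => idfun : {linear X n -> X n}) (fun _ _ => erefl).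

Definition cmap_comp (X Y Z : complex) (g : cmap Y Z) (f : cmap X Y) : cmap X Z.
Proof.
apply: (@Cmap X Z (fun n => cfun g n \o cfun f n : {linear X n -> Z n})).
by move=> n x; rewrite /= !cfun_dif.
Defined.

Definition Ch_cat : category.
Proof.
exists complex cmap cmap_id cmap_comp.
- by move=> *; apply: cmapP.
- by move=> *; apply: cmapP.
- by move=> *; apply: cmapP.
Defined.

(** The homology in degree [n + eps v] is the classes of cycles modulo
    [homologous]; every degree is of this form. *)
Definition is_cycle (X : complex) n (x : X n) : Prop := dif X n x = 0.

Definition homologous (X : complex) n (x x' : X (n + eps v)) : Prop :=
  exists y : X n, x - x' = dif X n y.

Definition quasi_iso (X Y : complex) (f : cmap X Y) : Prop :=
  forall n : int,
    class_bijective (@is_cycle X (n + eps v)) (@homologous X n)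
      (@is_cycle Y (n + eps v)) (@homologous Y n) (cfun f (n + eps v)).

Definition surj_in_range (X Y : complex) (f : cmap X Y) : Prop :=
  forall n, fib_range v r n -> forall y : Y n, exists x : X n, cfun f n x = y.

Definition Ch : model_cat := @ModelCat Ch_cat quasi_iso surj_in_range.

(** * Operads *)

(** A chain map out of the tensor product of [X] and [Y], given as a bilinear
    map; [p + q = n] is a hypothesis so as to avoid transport between degrees. *)
Record pairing (X Y Z : complex) := Pairing {
  pair_fun :> forall p q n : int, p + q = n -> X p -> Y q -> Z n;
  pair_linearl : forall p q n (h : p + q = n) y, linear (fun x => pair_fun h x y);
  pair_linearr : forall p q n (h : p + q = n) x, linear (pair_fun h x);
  pair_dif : forall p q n (h : p + q = n)
      (h1 : p + eps v + q = n + eps v) (h2 : p + (q + eps v) = n + eps v) x y,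
    dif Z n (pair_fun h x y) =
      pair_fun h1 (dif X p x) y + (-1) ^+ absz p *: pair_fun h2 x (dif Y q y) }.

Section Operads.
Variable C : Type.

(** The profile obtained from [c] by replacing its [i]-th color by [b]. *)
Definition ins (c : seq C) (i : nat) (b : seq C) : seq C :=
  take i c ++ b ++ drop i.+1 c.

(** The position in [ins c i b] of the color of [c] at [j != i], where [m] is
    the size of [b]; the color of [b] at [l] is at position [i + l]. *)
Definition outer (i m j : nat) : nat := (if j < i then j else (j + m).-1)%N.

(** The block permutation of [s] and [t] in an equivariant partial
    composition. *)
Definition is_block_perm (c c' b b' : seq C) (i : 'I_(size c))
    (s : prof_map c c') (t : prof_map b b')
    (w : prof_map (ins c i b) (ins c' (s i) b')) : Prop :=
  forall x : 'I_(size (ins c i b)),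
    (forall j : 'I_(size c), j != i -> val x = outer i (size b) j ->
       val (w x) = outer (s i) (size b') (s j)) /\
    (forall l : 'I_(size b), val x = (i + l)%N ->
       val (w x) = (s i + t l)%N).

(** Equal profiles are identified by the isomorphisms preserving positions. *)
Definition is_reindexing (c c' : seq C) (s : prof_map c c') : Prop :=
  forall i, val (s i) = val i.

(** The right action [x |-> x * s] of permutations. *)
Definition sact (X : symseq C Ch) (c c' : seq C) (d : C) (s : prof_map c c') :
    cmap (X (c', d)) (X (c, d)) :=
  @fmor _ _ X (c', d) (c, d) (s, erefl d).

(** Symmetric operads presented by units (maps from [k] in degree 0) and partial
    compositions [x \circ_i y] (maps out of a tensor product). *)
Record operad := Operad {
  osym :> symseq C Ch;
  ounit : forall c : C, deg (osym ([:: c], c)) 0;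
  ounit_cycle : forall c : C, dif (osym ([:: c], c)) 0 (ounit c) = 0;
  ocomp : forall (c : seq C) (d : C) (i : 'I_(size c)) (b : seq C) (e : C),
    color i = e ->
    pairing (osym (c, d)) (osym (b, e)) (osym (ins c i b, d));
  ounitl : forall (c : seq C) (d : C) (i : 'I_(size [:: d]))
      (h : color i = d) (s : prof_map (ins [:: d] i c) c) (p : int)
      (hp : 0 + p = p) (x : deg (osym (c, d)) p),
    is_reindexing s ->
    ocomp d c h _ _ _ hp (ounit d) x = sact osym d s p x;
  ounitr : forall (c : seq C) (d : C) (i : 'I_(size c)) (e : C)
      (h : color i = e) (s : prof_map (ins c i [:: e]) c) (p : int)
      (hp : p + 0 = p) (x : deg (osym (c, d)) p),
    is_reindexing s ->
    ocomp d [:: e] h _ _ _ hp x (ounit e) = sact osym d s p x;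
  (* (x o_i y) o_(i+j) z = x o_i (y o_j z) *)
  oassoc_seq : forall (c b a : seq C) (d e f : C)
      (i : 'I_(size c)) (j : 'I_(size b)) (ij : 'I_(size (ins c i b)))
      (hi : color i = e) (hj : color j = f) (hij : color ij = f)
      (s : prof_map (ins (ins c i b) ij a) (ins c i (ins b j a)))
      (p q n pq qn pqn : int) (h1 : p + q = pq) (h2 : pq + n = pqn)
      (h3 : q + n = qn) (h4 : p + qn = pqn)
      (x : deg (osym (c, d)) p) (y : deg (osym (b, e)) q)
      (z : deg (osym (a, f)) n),
    val ij = (i + j)%N -> is_reindexing s ->
    ocomp d a hij _ _ _ h2 (ocomp d b hi _ _ _ h1 x y) z =
      sact osym d s pqn
        (ocomp d _ hi _ _ _ h4 x (ocomp e a hj _ _ _ h3 y z));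
  (* (x o_i y) o_j z = (-1)^(|y||z|) (x o_j z) o_i y, with positions shifted *)
  oassoc_par : forall (c b a : seq C) (d e f : C)
      (i j : 'I_(size c)) (j' : 'I_(size (ins c i b)))
      (i' : 'I_(size (ins c j a)))
      (hi : color i = e) (hj : color j = f)
      (hj' : color j' = f) (hi' : color i' = e)
      (s : prof_map (ins (ins c i b) j' a) (ins (ins c j a) i' b))
      (p q n pq pn pqn : int) (h1 : p + q = pq) (h2 : pq + n = pqn)
      (h3 : p + n = pn) (h4 : pn + q = pqn)
      (x : deg (osym (c, d)) p) (y : deg (osym (b, e)) q)
      (z : deg (osym (a, f)) n),
    (i < j)%N -> val j' = outer i (size b) j -> val i' = outer j (size a) i ->
    is_reindexing s ->
    ocomp d a hj' _ _ _ h2 (ocomp d b hi _ _ _ h1 x y) z =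
      (-1) ^+ (absz q * absz n)
        *: sact osym d s pqn
          (ocomp d b hi' _ _ _ h4 (ocomp d a hj _ _ _ h3 x z) y);
  (* (x * s) o_i (y * t) = (x o_(s i) y) * (s o_i t) *)
  oequivariant : forall (c c' b b' : seq C) (d e : C) (i : 'I_(size c))
      (s : prof_map c c') (t : prof_map b b')
      (w : prof_map (ins c i b) (ins c' (s i) b'))
      (hi : color i = e) (hsi : color (s i) = e)
      (p q n : int) (hn : p + q = n)
      (x : deg (osym (c', d)) p) (y : deg (osym (b', e)) q),
    @is_block_perm c c' b b' i s t w ->
    ocomp d b hi _ _ _ hn (sact osym d s p x) (sact osym e t q y) =
      sact osym d w n (ocomp d b' hsi _ _ _ hn x y) }.

End Operads.

End Complexes.

(* Main.v *)
From HB Require Import structures.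
From mathcomp Require Import all_boot all_order all_fingroup all_algebra.
From mathcomp Require Import all_classical.
From mathcomp Require Import zify.
Require Import Defs.

(** Both assertions ask for a lift of a natural transformation [g : X -> V]
    through [b : U -> V], over a connected groupoid [D] with finite automorphism
    groups: the symmetric group for the first, the component of a profile for
    the second.  It is enough to lift [g] at one object [x0] of [D]: in
    characteristic zero, averaging a lift [h] over the conjugates
    [U(s) h X(s^-1)], [s] in [Aut x0], makes it equivariant without changing
    [b h = g] ([nat_lifts_average]), and an [Aut x0]-equivariant lift extends
    to [D] by transport along isomorphisms ([nat_lifts_connected]).

    It remains to lift a single chain map [g : W -> V] through a fibration
    [b : U -> V], with [W] colocal and [b] a colocal equivalence.  Over a field,
    complexes are determined up to homotopy by their homology, so that such a
    lift exists as soon as the image of [H(g)] is contained in the image of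
    [H(b)] ([chain_lift]).  This comes from [map(W, b)] being surjective on
    components ([map_weq_homology]): for a cosimplicial resolution [R] of [W]
    the map [R_0 -> W -> V] is joined by an edge [R_1 -> V] to a map that
    factors through [b]; both coface maps [R_0 -> R_1] induce on homology the
    inverse of [H(R_1) -> H(W)] composed with [H(R_0) -> H(W)], hence the ends
    of the edge agree on homology, and [H(R_0) -> H(W)] is onto.

    The lift is built degree by degree, without a choice of bases, from the fact
    that a linear relation contains the graph of a linear map on its domain,
    which may be prescribed compatibly on a subspace ([linear_selection]). *)

Set Implicit Arguments.
Unset Strict Implicit.
Unset Printing Implicit Defensive.

Import GRing.Theory.
Local Open Scope classical_set_scope.
Local Open Scope ring_scope.
Local Open Scope cat_scope.

(** * Linear selections of linear relations *)

Section LinearRelations.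
Variables (k : fieldType) (A B : lmodType k).
Implicit Types P G S N : set (A * B)%type.

Lemma linear_of_fun (f : A -> B) : linear f ->
  exists g : {linear A -> B}, forall x, g x = f x.
Proof.
move=> fL.
pose m := GRing.isLinear.Build k A B *:%R f fL.
pose g : {linear A -> B} := HB.pack f m.
by exists g.
Qed.

Definition linear_relation G : Prop :=
  G 0 /\ forall (c : k) x y, G x -> G y -> G (c *: x + y).

Definition functional G : Prop := forall b, G (0, b) -> b = 0.

(** [P] need not be total; over the points where it has no value, [G] is
    unconstrained.  This lets a selection be extended to the whole of [A] in the
    same construction. *)
Definition selects P G : Prop :=
  forall a b, G (a, b) -> (exists b', P (a, b')) -> P (a, b).

Lemma functional_uniq G a b b' : linear_relation G -> functional G ->
  G (a, b) -> G (a, b') -> b = b'.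
Proof.
move=> [_ GL] Gf ab ab'; apply/eqP; rewrite -subr_eq0; apply/eqP/Gf.
have := GL (-1) _ _ ab' ab.
rewrite (_ : _ + _ = (0, b - b')) //.
by congr pair; rewrite scaleN1r ?addNr 1?addrC.
Qed.

Definition adjoin G (a0 : A) (b0 : B) : set (A * B)%type :=
  [set x | exists c, G (x - c *: (a0, b0))].

Lemma adjoin_linear G a0 b0 :
  linear_relation G -> linear_relation (adjoin G a0 b0).
Proof.
move=> [G0 GL]; split; first by exists 0; rewrite scale0r subr0.
move=> c x y [c1 h1] [c2 h2]; exists (c * c1 + c2).
suff -> : c *: x + y - (c * c1 + c2) *: (a0, b0) =
  c *: (x - c1 *: (a0, b0)) + (y - c2 *: (a0, b0)) by apply: GL.
by rewrite scalerBr scalerA scalerDl opprD addrACA.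
Qed.

Lemma adjoin_functional G a0 b0 : linear_relation G -> functional G ->
  (forall b, ~ G (a0, b)) -> functional (adjoin G a0 b0).
Proof.
move=> [G0 GL] Gf a0G b [c h].
have [c0|c0] := eqVneq c 0.
  by apply: Gf; move: h; rewrite c0 scale0r subr0.
case: (a0G (b0 - c^-1 *: b)).
have := GL (- c^-1) _ _ h G0; rewrite addr0.
rewrite (_ : - c^-1 *: _ = (a0, b0 - c^-1 *: b)) //.
congr pair => /=.
  by rewrite sub0r scaleNr scalerN opprK scalerA mulVf ?scale1r.
by rewrite scaleNr scalerBr opprB scalerA mulVf ?scale1r.
Qed.

(** If the domain of [P] meets [a0 + dom G], the value of [P] at one common point
    dictates [b0]; any other choice differs from it by a pair to which the
    hypothesis on [G] applies.  Otherwise no new point of the domain of [P] is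
    reached, and [b0] is arbitrary. *)
Lemma adjoin_selects P G a0 : linear_relation P -> linear_relation G ->
  selects P G -> exists b0, selects P (adjoin G a0 b0).
Proof.
move=> [P0 PL] [G0 GL] sG.
have [[a [b [b0 [Gab Pab]]]]|no] :=
  EM (exists a b b0, G (a, b) /\ P (a0 + a, b0 + b)).
- exists b0 => a' b' [c h] [b1 P1].
  have h2 : G ((a', b') - c *: (a0 + a, b0 + b)).
    rewrite (_ : _ - _ = (- c) *: (a, b) + ((a', b') - c *: (a0, b0))).
      exact: GL.
    rewrite (_ : (a0 + a, b0 + b) = (a0, b0) + (a, b)) //.
    by rewrite scalerDr scaleNr opprD addrA [RHS]addrC.
  have P2 : P ((a', b') - c *: (a0 + a, b0 + b)).
    apply: sG h2 _; exists (b1 - c *: (b0 + b)).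
    by have := PL (- c) _ _ Pab P1; rewrite scaleNr addrC.
  by have := PL c _ _ Pab P2; rewrite addrC subrK.
- exists 0 => a' b' [c h] [b1 P1].
  have [c0|c0] := eqVneq c 0.
    by apply: sG; [move: h; rewrite c0 scale0r subr0 | exists b1].
  case: no; exists (c^-1 *: (a' - c *: a0)), (c^-1 *: (b' - c *: 0)).
  exists (c^-1 *: b1 - (c^-1 *: (b' - c *: 0))); split.
    by have := GL c^-1 _ _ h G0; rewrite addr0.
  rewrite subrK scalerBr scalerA mulVf // scale1r subrKC.
  by have := PL c^-1 _ _ P1 P0; rewrite addr0.
Qed.

(** Zorn's lemma for the functional linear relations that contain [G] and select
    [P]: a maximal one is total, since adjoining a point outside its domain would
    enlarge it. *)
Lemma linear_selection P G : linear_relation P -> linear_relation G ->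
  functional G -> selects P G ->
  exists f : {linear A -> B},
    (forall a b, G (a, b) -> f a = b) /\
    (forall a, (exists b, P (a, b)) -> P (a, f a)).
Proof.
move=> PL GL Gf Gs.
(* Zorn's lemma is applied to sets [S] such that [G `|` S] is good, so that the
   empty chain has an upper bound. *)
pose good N := [/\ linear_relation N, functional N & selects P N].
have [F goodF totF|S [[SL Sf Ss] Smax]] :=
    @Zorn_bigcup (A * B)%type (fun S => good (G `|` S)).
  (* Every element of the union is in some good [G `|` X], and any two of them
     are in a common one because [F] is a chain. *)
  have in1 (x : A * B) : (G `|` \bigcup_(X in F) X) x ->
      exists X, [/\ good (G `|` X), (G `|` X) x &
        G `|` X `<=` G `|` \bigcup_(X in F) X].
    case=> [Gx|[X FX Xx]].
      by exists set0; rewrite setU0; split=> // y Gy; left.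
    exists X; split; [exact: goodF | by right |].
    by move=> y [?|?]; [left | right; exists X].
  have [G0 _] := GL.
  split.
  - split; first by left.
    move=> c x y hx hy.
    suff [X [[[_ XL] _ _] Xx Xy XF]] : exists X,
        [/\ good (G `|` X), (G `|` X) x, (G `|` X) y & G `|` X `<=` G `|` \bigcup_(X in F) X].
      exact/XF/XL.
    case: hx => [Gx|[X FX Xx]].
      by have [X [? ? ?]] := in1 _ hy; exists X; split=> //; left.
    case: hy => [Gy|[Y FY Yy]].
      have [|X' [? ? ?]] := in1 x; first by right; exists X.
      by exists X'; split=> //; left.
    have [XY|YX] := totF _ _ FX FY.
    + exists Y; split; [exact: goodF | by right; exact: XY | by right |].
      by move=> z [?|?]; [left | right; exists Y].
    + exists X; split; [exact: goodF | by right | by right; exact: YX |].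
      by move=> z [?|?]; [left | right; exists X].
  - by move=> b /in1[X [[_ Xf _] Xb _]]; exact: Xf.
  - by move=> a b /in1[X [[_ _ Xs] Xab _]]; exact: Xs.
set N := G `|` S in SL Sf Ss.
have total a : exists b, N (a, b).
  apply/not_existsP => aN.
  have [b0 sN] := adjoin_selects a PL SL Ss.
  have NH : N `<=` adjoin N a b0.
    by move=> x Nx; exists 0; rewrite scale0r subr0.
  have Hab0 : adjoin N a b0 (a, b0).
    by exists 1; rewrite scale1r subrr; case: SL.
  apply: (Smax (adjoin N a b0)).
    split; first by move=> x Sx; apply: NH; right.
    by move=> HS; apply: (aN b0); right; exact: HS.
  rewrite setUidr; last by move=> x Gx; apply: NH; left.
  by split; [exact: adjoin_linear | exact: adjoin_functional |].
have [f0 f0N] := choice total.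
have [|f fE] := @linear_of_fun f0.
  move=> c x y.
  apply: (functional_uniq SL Sf (f0N _)).
  by case: SL => _ /(_ c _ _ (f0N x) (f0N y)).
exists f; split=> [a b Gab|a aP]; rewrite fE.
- by apply: (functional_uniq SL Sf (f0N _)); left.
- exact: Ss.
Qed.

End LinearRelations.

(** * Lifting chain maps over a field *)

Section Complexes.
Variables (k : fieldType) (v : direction) (r : grading).
Implicit Types X Y U V W : Ch k v r.

(** The target degree is a variable, as every degree [m] is of the form
    [n + eps v] only up to an equation. *)
Definition dif_to (X : complex k v r) n m (e : n + eps v = m) :
    {linear X n -> X m} :=
  let: erefl := e in dif X n.

(** The only degree in the range where a fibration may fail to be surjective is
    the end of the complex, where the differential leads out of the range. *)
Lemma fib_range_or n : fib_range v r n || ~~ in_range r (n + eps v).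
Proof. by case: v r => [] [] //=; rewrite -?ltNge -?leNgt; lia. Qed.

(** The image of [H(g)] is contained in the image of [H(b)]. *)
Definition homology_image_sub W U V (b : hom U V) (g : hom W V) : Prop :=
  forall n (w : deg W (n + eps v)), dif W _ w = 0 ->
  exists u : deg U (n + eps v), dif U _ u = 0 /\
    homologous (cfun g _ w) (cfun b _ u).

Section Lift.
Variables (W U V : Ch k v r) (b : hom U V) (g : hom W V).
Hypotheses (bF : fib b) (bg : homology_image_sub b g).

(** A cycle of [U] whose image is homologous to [g w] is corrected by the boundary
    of a preimage under [b] of the chain that bounds the difference. *)
Lemma cycle_lift m (w : deg W m) : dif W _ w = 0 ->
  exists u : deg U m, cfun b _ u = cfun g _ w /\ dif U _ u = 0.
Proof.
rewrite -(subrK (eps v) m) in w *.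
move: (m - _) w => {m} n w w0.
have [u [u0 [y gwE]]] := bg w0.
have [nF|nR] := orP (fib_range_or n).
  have [x bx] := bF nF y.
  exists (u + dif U _ x); rewrite !linearD /= cfun_dif bx -gwE subrKC u0.
  by rewrite dif2 addr0.
exists 0; rewrite !linear0; split=> //.
by rewrite (deg_range nR (cfun g _ w)).
Qed.

(** The second condition is what makes [dif U (t w)] a function of [dif W w]. *)
Lemma degreewise_lift m : exists t : {linear deg W m -> deg U m},
  (forall w, cfun b _ (t w) = cfun g _ w) /\
  (forall w, dif W _ w = 0 -> dif U _ (t w) = 0).
Proof.
pose Z : set (deg W m * deg U m)%type :=
  [set x | [/\ dif W _ x.1 = 0, dif U _ x.2 = 0 & cfun b _ x.2 = cfun g _ x.1]].
have ZL : linear_relation Z.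
  split; first by rewrite /Z /= !linear0.
  move=> c [x1 x2] [y1 y2] [/= h1 h2 h3] [/= h4 h5 h6].
  by split; rewrite /= !linearP /= ?h1 ?h2 ?h3 ?h4 ?h5 ?h6 ?scaler0 ?addr0.
(* A linear choice of lifts of the cycles, by cycles, which is then extended to
   lifts of all elements. *)
have [] := linear_selection (G := [set 0]) ZL.
- by split=> // c x y -> ->; rewrite scaler0 addr0.
- by move=> y [].
- by move=> x y [-> ->] _; case: ZL.
move=> z [_ zZ].
have {}zZ w : dif W _ w = 0 -> Z (w, z w).
  by move=> w0; apply: zZ; have [u [? ?]] := cycle_lift w0; exists u.
pose P : set (deg W m * deg U m)%type := [set x | cfun b _ x.2 = cfun g _ x.1].
pose G : set (deg W m * deg U m)%type :=
  [set x | dif W _ x.1 = 0 /\ x.2 = z x.1].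
have PL : linear_relation P.
  split; first by rewrite /P /= !linear0.
  by move=> c x y; rewrite /P /= !linearP => -> ->.
have [] := linear_selection (G := G) PL.
- split; first by rewrite /G /= !linear0.
  move=> c x y [/= h1 h2] [h3 h4].
  by rewrite /G /= !linearP h1 h3 h2 h4 scaler0 addr0.
- by move=> y [_ /= ->]; rewrite linear0.
- by move=> x y [/= h1 h2] _; rewrite /P h2 /=; case: (zZ _ h1).
move=> t [tG tP]; exists t; split=> w.
- apply: (tP w); have [mF|mR] := orP (fib_range_or m); last first.
    by have [u [bu _]] := cycle_lift (deg_range mR (dif W _ w)); exists u.
  by have [x bx] := bF mF (cfun g m w); exists x.
- by move=> w0; rewrite (tG w (z w)) //; case: (zZ w w0).
Qed.

(** Degreewise lifts [t] that preserve cycles give the chain map [f] that is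
    [dif w |-> dif (t w)] on boundaries and has [dif \o f = dif \o t]: this
    prescription is well defined because [t] preserves cycles, and [t] itself
    shows that it can be met at every single element. *)
Lemma chain_lift : exists h : hom W U, b ∘ h = g.
Proof.
pose t m := sval (boolp.cid (degreewise_lift m)).
have tb m w : cfun b _ (t m w) = cfun g _ w.
  by case: (svalP (boolp.cid (degreewise_lift m))).
have tZ m w : dif W _ w = 0 -> dif U _ (t m w) = 0.
  by case: (svalP (boolp.cid (degreewise_lift m))) => _; exact.
pose good m (f : {linear deg W m -> deg U m}) :=
  [/\ forall w, cfun b _ (f w) = cfun g _ w,
      forall w, dif U _ (f w) = dif U _ (t m w) &
      forall n (e : n + eps v = m) w,
        f (dif_to W e w) = dif_to U e (t n w)].
have exf m : exists f, @good m f.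
  rewrite /good; rewrite -(subrK (eps v) m); move: (m - _) => {m} n.
  pose P : set (deg W (n + eps v) * deg U (n + eps v))%type :=
    [set x | cfun b _ x.2 = cfun g _ x.1 /\ dif U _ x.2 = dif U _ (t _ x.1)].
  pose G : set (deg W (n + eps v) * deg U (n + eps v))%type :=
    [set x | exists2 w, x.1 = dif W _ w & x.2 = dif U _ (t _ w)].
  have PL : linear_relation P.
    split; first by rewrite /P /= !linear0.
    by move=> c x y [h1 h2] [h3 h4]; rewrite /P /= !linearP /= h1 h2 h3 h4.
  have [] := linear_selection (G := G) PL.
  - split; first by exists 0; rewrite /= !linear0.
    move=> c x y [w h1 h2] [w' h3 h4]; exists (c *: w + w').
      by rewrite /= h1 h3 !linearP.
    by rewrite /= h2 h4 !linearP.
  - by move=> y [w /= e ->]; apply: tZ.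
  - move=> x y [w /= -> ->] _; split=> /=.
      by rewrite cfun_dif tb -cfun_dif.
    by rewrite dif2 tZ // dif2.
  move=> f [fG fP]; exists f.
  have {}fP w : P (w, f w) by apply: fP; exists (t _ w); split; first exact: tb.
  split.
  - by move=> w; case: (fP w).
  - by move=> w; case: (fP w).
  - move=> n' e w; have e' := addIr _ e; subst n'.
    by rewrite (eq_irrelevance e erefl) /=; apply: fG; exists w.
pose f m := sval (boolp.cid (exf m)).
have fP m : good m (f m) := svalP (boolp.cid (exf m)).
have fd n (w : deg W n) : f _ (dif W n w) = dif U n (f n w).
  have [_ fd _] := fP n; have [_ _ fb] := fP (n + eps v).
  by rewrite fd; apply: (fb n erefl).
exists (@Cmap _ _ _ W U f fd); apply: cmapP => n w /=.
by have [fb _ _] := fP n; apply: fb.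
Qed.

End Lift.

(** The class of [w] comes from a cycle [x] of [R_0], and the ends of the edge [h]
    send [x] to homologous cycles, because the two coface images of [x] have the
    same image under the quasi-isomorphism [R_1 -> W]. *)
Lemma map_weq_homology W U V (b : hom U V) (g : hom W V) :
  map_weq W b -> homology_image_sub b g.
Proof.
move=> [R [e [[_ eW] [[_ _ surj] _]]]] n w w0.
have [u _ [h [h0 h1]]] := surj (g ∘ e 0%N) I.
have [_ _ /(_ w w0)[x x0 [y yE]]] := eW 0%N n.
pose d i : hom (R 0%N) (R 1%N) := @fmor _ _ R 0%N 1%N (coface i).
have ed i : e 1%N ∘ d i = e 0%N by rewrite ncompE; exact: ccomp1l.
have dx0 i : is_cycle (cfun (d i) _ x).
  by rewrite /is_cycle -cfun_dif x0 linear0.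
have [_ inj _] := eW 1%N n.
have edx i : cfun (e 1%N) _ (cfun (d i) _ x) = cfun (e 0%N) _ x.
  by rewrite -(ed i).
have [|z zE] := (inj _ _ (dx0 ord0) (dx0 ord_max)).1.
  by exists 0; rewrite !edx linear0 subrr.
exists (cfun u _ x); split; first by rewrite -cfun_dif x0 linear0.
exists (- (cfun g _ y + cfun h _ z)).
have bu : cfun b _ (cfun u _ x) = cfun h _ (cfun (d ord0) _ x).
  by have := congr1 (fun f : cmap (R 0%N) V => cfun f _ x) h0.
have ge : cfun g _ (cfun (e 0%N) _ x) = cfun h _ (cfun (d ord_max) _ x).
  by have := congr1 (fun f : cmap (R 0%N) V => cfun f _ x) h1.
rewrite linearN linearD -!cfun_dif -zE -yE !linearB ge bu.
by rewrite /= opprD !opprB addrA subrK.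
Qed.

Lemma colocal_lift (K : Ch k v r -> Prop) W U V (b : hom U V) (g : hom W V) :
  colocal K W -> fib b -> colocal_equivalence K b ->
  exists h : hom W U, b ∘ h = g.
Proof.
by move=> [_ W_K] bF bK; apply/chain_lift/map_weq_homology/W_K.
Qed.
End Complexes.

(** * Equivariant lifts over finite groupoids *)

Definition groupoid (D : category) : Prop :=
  forall (x y : D) (f : hom x y),
    exists f' : hom y x, f' ∘ f = cid x /\ f ∘ f' = cid y.

Definition finite_enum (T : Type) : Prop :=
  exists (I : finType) (e : I -> T), bijective e.

Lemma finite_enum_inj (T : Type) (J : finType) (phi : T -> J) :
  injective phi -> finite_enum T.
Proof.
move=> phi_inj.
pose I := {j : J | `[< exists t, phi t = j >]}.
have surj (i : I) : exists t, phi t = val i by exact: (asboolW (valP i)).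
have phiP t : `[< exists t', phi t' = phi t >] by apply/asboolP; exists t.
pose e i := sval (boolp.cid (surj i)).
have eP i : phi (e i) = val i := svalP (boolp.cid (surj i)).
exists I, e, (fun t => exist _ (phi t) (phiP t)) => [i|t].
- by apply: val_inj; rewrite /= eP.
- by apply: phi_inj; rewrite eP.
Qed.

(** The lift at [x] is [h] conjugated by a chosen isomorphism [x0 -> x]; two
    choices differ by an automorphism of [x0], with which [h] commutes. *)
Lemma nat_lifts_connected (D M : category) (X U V : functor D M)
    (b : nattrans U V) (g : nattrans X V) (x0 : D) (h : hom (X x0) (U x0)) :
  groupoid D -> (forall x, inhabited (hom x0 x)) ->
  b x0 ∘ h = g x0 ->
  (forall s : hom x0 x0, fmor U s ∘ h = h ∘ fmor X s) ->
  nat_lifts b g.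
Proof.
move=> Dinv Dconn bh hs.
have exto x : exists f : hom x0 x * hom x x0,
    f.2 ∘ f.1 = cid x0 /\ f.1 ∘ f.2 = cid x.
  by have [f] := Dconn x; have [f' ?] := Dinv _ _ f; exists (f, f').
pose to x := (sval (boolp.cid (exto x))).1.
pose from x := (sval (boolp.cid (exto x))).2.
have toK x : to x ∘ from x = cid x by case: (svalP (boolp.cid (exto x))).
pose H x : hom (X x) (U x) := fmor U (to x) ∘ h ∘ fmor X (from x).
have HE x y (f : hom x y) : H y ∘ fmor X f = fmor U f ∘ H x.
  pose s := from y ∘ f ∘ to x.
  have sE : from y ∘ f = s ∘ from x by rewrite -ccompA toK ccomp1r.
  have tE : to y ∘ s = f ∘ to x by rewrite !ccompA toK ccomp1l.
  rewrite /H -ccompA -fmor_comp sE fmor_comp !ccompA -fmor_comp -tE.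
  by rewrite fmor_comp -!ccompA; congr (_ ∘ _); rewrite !ccompA hs.
exists (Nattrans HE) => x /=.
rewrite /H !ccompA ncompE -(ccompA _ (b x0)) bh -ncompE.
by rewrite -ccompA -fmor_comp toK fmor_id ccomp1r.
Qed.

Section Averaging.
Variables (k : fieldType) (v : direction) (r : grading).

Lemma cmap_average (W U : Ch k v r) (I : finType) (F : I -> hom W U) :
  exists A : hom W U, forall n w,
    cfun A n w = #|I|%:R^-1 *: \sum_i cfun (F i) n w.
Proof.
have exA n : exists a : {linear deg W n -> deg U n},
    forall w, a w = #|I|%:R^-1 *: \sum_i cfun (F i) n w.
  apply: linear_of_fun => c x y.
  under eq_bigr => i _ do rewrite linearP.
  by rewrite big_split /= -scaler_sumr scalerDr !scalerA mulrC.
pose a n := sval (boolp.cid (exA n)).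
have aE n w : a n w = _ := svalP (boolp.cid (exA n)) w.
have ad n (w : deg W n) : a _ (dif W n w) = dif U n (a n w).
  rewrite !aE linearZ (linear_sum (dif U n)) /=; congr (_ *: _).
  by apply: eq_bigr => i _; rewrite cfun_dif.
by exists (@Cmap _ _ _ W U a ad).
Qed.

Hypothesis char0 : [pchar k] =i pred0.

(** The average of the conjugates of [h] by the automorphisms of [x0] is a lift
    since each conjugate is one, and is equivariant since composition with an
    automorphism permutes the conjugates. *)
Lemma nat_lifts_average (D : category) (X U V : functor D (Ch k v r))
    (b : nattrans U V) (g : nattrans X V) (x0 : D) :
  groupoid D -> (forall x, inhabited (hom x0 x)) ->
  finite_enum (hom x0 x0) ->
  (exists h : hom (X x0) (U x0), b x0 ∘ h = g x0) -> nat_lifts b g.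
Proof.
move=> Dinv Dconn [I [e [e' eK e'K]]] [h bh].
pose inv s := sval (boolp.cid (Dinv x0 x0 s)).
have invl s : inv s ∘ s = cid x0 by case: (svalP (boolp.cid (Dinv x0 x0 s))).
have invr s : s ∘ inv s = cid x0 by case: (svalP (boolp.cid (Dinv x0 x0 s))).
pose F i : hom (X x0) (U x0) := fmor U (e i) ∘ h ∘ fmor X (inv (e i)).
have [A AE] := cmap_average F.
have I0 : #|I|%:R != 0 :> k.
  rewrite ((pcharf0P k).1 char0); apply/eqP => /eqP/fintype.pred0Pn.
  by apply; exists (e' (cid x0)).
have bF i : b x0 ∘ F i = g x0.
  rewrite /F !ccompA ncompE -(ccompA _ (b x0)) bh -ncompE.
  by rewrite -ccompA -fmor_comp invr fmor_id ccomp1r.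
apply: (@nat_lifts_connected _ _ _ _ _ b g x0 A) => //.
  apply: cmapP => n w /=; rewrite AE linearZ (linear_sum (cfun (b x0) n)) /=.
  rewrite (eq_bigr (fun=> cfun (g x0) n w)); last first.
    by move=> i _; rewrite -(bF i).
  by rewrite sumr_const -scaler_nat scalerA mulVf ?scale1r.
move=> s; apply: cmapP => n w /=.
rewrite !AE linearZ (linear_sum (cfun (fmor U s) n)) /=; congr (_ *: _).
rewrite [RHS](reindex (fun i => e' (s ∘ e i))) /=; last first.
  exists (fun i => e' (inv s ∘ e i)) => i _.
    by rewrite e'K ccompA invl ccomp1l eK.
  by rewrite e'K ccompA invr ccomp1l eK.
apply: eq_bigr => i _.
have FE : F (e' (s ∘ e i)) ∘ fmor X s = fmor U s ∘ F i.
  have invM : inv (s ∘ e i) ∘ s = inv (e i).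
    by rewrite -[LHS]ccomp1r -(invr (e i)) ccompA -(ccompA _ s) invl ccomp1l.
  by rewrite /F e'K -ccompA -fmor_comp invM fmor_comp !ccompA.
exact: (congr1 (fun f : cmap (X x0) (U x0) => cfun f n w) (esym FE)).
Qed.

End Averaging.

(** * Symmetric groups and orbits of profiles *)

Lemma Sigma_groupoid n : groupoid (op (Sigma n)).
Proof.
by move=> x y f; exists (f^-1)%g; rewrite /= mulgV mulVg.
Qed.

Section Orbits.
Variables (C : Type) (c : seq C) (d : C).

Lemma prof_map_inv (a b : seq C) (s : prof_map a b) :
  exists t : prof_map b a, cancel s t /\ cancel t s.
Proof.
have [t st ts] := prof_bij s.
have tb : bijective t by exists s.
have tc i : color (t i) = color i by rewrite -(prof_color s) ts.
by exists (ProfMap tb tc).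
Qed.

Lemma orbit_groupoid : groupoid (orbit_at c d).
Proof.
move=> [[a a'] ax] [[b b'] bx] [/= s e].
have [t [st ts]] := prof_map_inv s.
exists (t, esym e); split; congr pair.
- by apply: prof_mapP => i; rewrite /= ts.
- exact: Prop_irrelevance.
- by apply: prof_mapP => i; rewrite /= st.
- exact: Prop_irrelevance.
Qed.

Definition orbit_base : orbit_at c d :=
  exist _ (c, d) (conj (inhabits (prof_map_id c)) erefl).

Lemma orbit_connected (x : orbit_at c d) : inhabited (hom orbit_base x).
Proof.
case: x => [[a a'] [/= [s] e]].
have [t _] := prof_map_inv s.
by constructor; exact: (t, esym e).
Qed.

Lemma orbit_finite : finite_enum (hom orbit_base orbit_base).
Proof.
pose phi (s : hom orbit_base orbit_base) := [ffun i => prof_fun s.1 i].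
apply: (@finite_enum_inj _ _ phi) => -[s e] [s' e'] /ffunP ss'.
congr pair; last exact: (@Prop_irrelevance (d = d)).
by apply: prof_mapP => i; have := ss' i; rewrite !ffunE.
Qed.

End Orbits.

Theorem theorem11p12 (k : fieldType) (hk : ([pchar k]%R =i pred0))
    (v : direction) (r : grading)
    (K : Ch k v r -> Prop) (hK : forall A, K A -> cofibrant A) :
  diamond K /\
  forall (C : Type) (hC : inhabited C) (O : operad k v r C),
    objectwise_colocal K O -> star K O.
Proof.
split=> [n _ X U V b XK bF bK g|C _ O OK E B p pK c d g].
- apply: (@nat_lifts_average _ _ _ hk _ _ _ _ b g tt).
  + exact: Sigma_groupoid.
  + by case; constructor; exact: 1%g.
  + by exists {perm 'I_n}, id, id.
  + exact: colocal_lift XK bF bK.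
- have [pF pW] := pK c d.
  apply: (@nat_lifts_average _ _ _ hk _ _ _ _ _ g (orbit_base c d)).
  + exact: orbit_groupoid.
  + exact: orbit_connected.
  + exact: orbit_finite.
  + exact: colocal_lift (OK c d) pF pW.
Qed.
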